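(* There exist absolute constants $C_1,C_2>0$ such that $$\left\lfloor\frac{n^2}{4}\right\rfloor-C_1n^{4/3}\;\leq\;\sigma_n\;\leq\;\left\lfloor\frac{n^2}{4}\right\rfloor-C_2n^{4/3}$$ for every sufficiently large integer $n$, where $\sigma_n=\max_{|V(G)|=n}\bigl(\operatorname{cp}(G)-\operatorname{cc}(G)\bigr)$, the maximum being over all graphs $G$ on $n$ vertices.
   Context: All graphs are finite, simple and undirected. A clique of a graph $G$ is a complete subgraph of $G$ (cliques of order two, i.e. single edges, are allowed). A clique covering of $G$ is a family of cliques of $G$ whose union contains $E(G)$. A clique partition of $G$ is a clique covering in which every edge of $G$ lies in exactly one member of the family. $\operatorname{cc}(G)$ and $\operatorname{cp}(G)$ denote the minimum possible number of members of a clique covering and of a clique partition of $G$, respectively. *)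

(* Defs.v *)
From HB Require Import structures.
From mathcomp Require Import all_boot.

Set Implicit Arguments.
Unset Strict Implicit.
Unset Printing Implicit Defensive.

(* A finite simple graph on the vertex set T, given by its set of edges,
   which are unordered pairs of distinct vertices. *)
Record sgraph (T : finType) := SGraph {
  edges :> {set {set T}};
  edgesP : [forall e in edges, #|e| == 2]
}.

HB.instance Definition _ (T : finType) := [isSub for @edges T].
HB.instance Definition _ (T : finType) := [Finite of sgraph T by <:].

Section CliqueFamilies.
Variables (T : finType) (G : sgraph T).
Implicit Types (A e : {set T}) (F : {set {set T}}).

(* A complete subgraph is determined by its vertex set. *)
Definition clique A : bool :=
  [forall x in A, forall y in A, (x != y) ==> ([set x; y] \in edges G)].

(* Families are taken without repetition: deleting repeated members (or, in
   the case of partitions, repeated edgeless ones) preserves both properties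
   below, so this does not affect the minimum sizes. *)
Definition clique_covering F : bool :=
  [forall A in F, clique A]
  && [forall e in edges G, exists A in F, e \subset A].

Definition clique_partition F : bool :=
  clique_covering F
  && [forall e in edges G, #|[set A in F | e \subset A]| == 1].

Lemma edges_clique_partition : clique_partition (edges G).
Proof.
have card2 e : e \in edges G -> #|e| = 2.
  by move=> eG; apply/eqP; exact: (forall_inP (edgesP G)).
apply/andP; split; first (apply/andP; split).
- apply/forall_inP => e eG; apply/forall_inP => x xe; apply/forall_inP => y ye.
  apply/implyP => xy; suff -> : [set x; y] = e by [].
  apply/eqP; rewrite eqEcard cards2 xy (card2 _ eG) andbT.
  by apply/subsetP => z /set2P[] ->.
- by apply/forall_inP => e eG; apply/exists_inP; exists e.
- apply/forall_inP => e eG; apply/eqP.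
  suff -> : [set A in edges G | e \subset A] = [set e] by rewrite cards1.
  apply/setP => A; rewrite !inE; apply/andP/eqP => [[AG eA]|-> //].
  by apply/esym/eqP; rewrite eqEcard eA !card2.
Qed.

Lemma edges_clique_covering : clique_covering (edges G).
Proof. by case/andP: edges_clique_partition. Qed.

(* The edge set, a valid clique partition, is the witness that [arg min]
   requires. *)
Definition cc : nat := #|[arg min_(F < edges G | clique_covering F) #|F|]|.

Definition cp : nat := #|[arg min_(F < edges G | clique_partition F) #|F|]|.

Lemma ccP : (exists2 F, clique_covering F & #|F| = cc)
  /\ forall F, clique_covering F -> cc <= #|F|.
Proof.
rewrite /cc; case: arg_minnP => [|F FG Fmin]; first exact: edges_clique_covering.
by split; [exists F|].
Qed.

Lemma cpP : (exists2 F, clique_partition F & #|F| = cp)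
  /\ forall F, clique_partition F -> cp <= #|F|.
Proof.
rewrite /cp; case: arg_minnP => [|F FG Fmin]; first exact: edges_clique_partition.
by split; [exists F|].
Qed.

Lemma cc_le_cp : cc <= cp.
Proof. by case: cpP => -[F /andP[FG _] <-] _; apply: ccP.2. Qed.

End CliqueFamilies.

(* The truncated subtraction is harmless by cc_le_cp. *)
Definition sigma (n : nat) : nat := \max_(G : sgraph 'I_n) (cp G - cc G).

(* Main.v *)
Require Import Defs.
From mathcomp Require Import all_boot all_order all_algebra.
From mathcomp Require Import reals exp.
From mathcomp Require Import zify ring lra.

Set Implicit Arguments.
Unset Strict Implicit.
Unset Printing Implicit Defensive.

(* Up to constants put k = n^(1/3), so that the error term is n k.

   Lower bound: join two halves completely and split each half into disjoint
   cliques of size k. About (n/k)^2 cliques cover this graph, while a partition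
   cannot save more on the n^2/4 cross edges than the O(n k) edges inside the
   halves allow.

   Upper bound: repeatedly delete a vertex v of minimum degree together with a
   maximum matching M of its neighbourhood. The triangles v + M and the other
   edges at v give a partition with floor(n^2/4) - (total gain) members, where
   a step with m vertices left gains floor(m/2) + |M| - deg v >= 0. Suppose
   that the total gain is o(n k). In a sparse graph |M| = O(gain), so only
   o(n k) edges are deleted through matchings, and almost every step gains less
   than k; its neighbourhood is then, up to O(k) vertices, an independent set of
   nearly half the remaining vertices. Comparing the first such step with the
   later ones gives vertex sets X and Y with at most n k edges inside each and
   quadratically many edges across. A clique without vertices of high inner
   degree covers O(k^2) of the cross edges, so cc is of order n^2/k^2 = n k.
   Dense graphs are settled by the triples x + y + z = 0 in Z/n. *)

(** * Matchings in edge sets *)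

Section EdgeSets.
Variable T : finType.
Implicit Types (E M F P : {set {set T}}) (A S e : {set T}) (x y z : T).

(** Edge sets stay bare sets with a side condition, since the elimination deletes edges at every
    step. *)
Definition graph E := {in E, forall e, #|e| = 2}.

Definition nb E x := [set y | [set x; y] \in E].

Definition star E x := [set e in E | x \in e].

Lemma graphS E F : F \subset E -> graph E -> graph F.
Proof. by move=> /subsetP FE gE e /FE/gE. Qed.

Lemma nb_neq E x y : graph E -> y \in nb E x -> x != y.
Proof. by move=> gE; rewrite inE => /gE; rewrite cards2; case: (x != y). Qed.

Lemma nbS E F x : F \subset E -> nb F x \subset nb E x.
Proof. by move=> /subsetP FE; apply/subsetP => y; rewrite !inE; apply: FE. Qed.

Lemma pair_inj x : injective (fun y => [set x; y]).
Proof.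
move=> y z E; have : y \in [set x; z] by rewrite -E set22.
have : z \in [set x; y] by rewrite E set22.
by case/set2P=> [->|->//]; case/set2P=> ->.
Qed.

Lemma graph_pair E e x : graph E -> e \in E -> x \in e -> exists2 y, x != y & e = [set x; y].
Proof.
move=> gE eE xe; have e2 := gE _ eE.
have /cards1P[y ey] : #|e :\ x| == 1 by have := cardsD1 x e; rewrite xe e2; lia.
have : y \in e :\ x by rewrite ey set11.
by rewrite !inE => /andP[yx _]; exists y; rewrite 1?eq_sym // -ey setD1K.
Qed.

Lemma graph_pairP E e : graph E -> e \in E -> exists x y, x != y /\ e = [set x; y].
Proof. by move=> gE /gE/eqP/cards2P[x [y [xy ->]]]; exists x, y. Qed.

Lemma starE E x : graph E -> star E x = [set [set x; y] | y in nb E x].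
Proof.
move=> gE; apply/setP => e; rewrite inE; apply/andP/imsetP => [[eE xe]|[y yx ->]].
  by have [y xy ee] := graph_pair gE eE xe; exists y; rewrite // inE -ee.
by rewrite set21; split=> //; rewrite inE in yx.
Qed.

Lemma card_star E x : graph E -> #|star E x| = #|nb E x|.
Proof. by move=> gE; rewrite starE // card_imset //; apply: pair_inj. Qed.

Lemma handshake E : graph E -> \sum_x #|nb E x| = 2 * #|E|.
Proof.
move=> gE; under eq_bigr do rewrite -card_star // -sum1dep_card big_mkcondr /=.
rewrite exchange_big /= mulnC -sum_nat_const; apply: eq_bigr => e eE.
by rewrite -big_mkcond sum1_card (gE _ eE).
Qed.

(** Markov's inequality for degrees. *)
Lemma card_high E K : graph E -> #|[set x | K < #|nb E x|]| * K.+1 <= 2 * #|E|.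
Proof.
move=> gE; rewrite -handshake // -sum_nat_const.
rewrite [leqRHS](bigID (mem [set x | K < #|nb E x|])) /=.
by apply/(leq_trans _ (leq_addr _ _))/leq_sum => x; rewrite inE.
Qed.

(** Edge-disjoint triangles: distinct triples share an edge exactly when they have two common
    vertices. *)
Definition packing E P :=
  {in P, forall A, #|A| = 3 /\ {in A &, forall x y, x != y -> [set x; y] \in E}}
  /\ {in P &, forall A B, A != B -> #|A :&: B| <= 1}.

Definition matching E S M := [&& M \subset E, trivIset M & cover M \subset S].

Definition max_matching E S : {set {set T}} := [arg max_(M > set0 | matching E S M) #|M|].

Lemma max_matchingP E S : matching E S (max_matching E S)
  /\ forall M, matching E S M -> #|M| <= #|max_matching E S|.
Proof.
rewrite /max_matching; case: arg_maxnP => [|M MM Mmax]; last by split.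
rewrite /matching sub0set /cover big_set0 sub0set andbT.
by apply/trivIsetP => A B; rewrite inE.
Qed.

Lemma matching_cover E S M : graph E -> matching E S M -> #|cover M| = 2 * #|M|.
Proof.
move=> gE /and3P[/subsetP ME /eqP <- _].
by rewrite mulnC -sum_nat_const; apply: eq_bigr => e /ME/gE.
Qed.

Lemma notin_matching x M e : x \notin cover M -> e \in M -> x \notin e.
Proof. by move=> xM eM; apply: contra xM => xe; apply/bigcupP; exists e. Qed.

Lemma matchingU1 E S M x y : graph E -> matching E S M -> [set x; y] \in E ->
  x \in S -> y \in S -> x \notin cover M -> y \notin cover M ->
  matching E S ([set x; y] |: M) /\ #|[set x; y] |: M| = #|M|.+1.
Proof.
move=> gE /and3P[ME tM cM] xyE xS yS xM yM.
have d : {in M, forall B : {set T}, [disjoint [set x; y] & B]}.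
  move=> B BM; rewrite disjoint_subset; apply/subsetP => z /set2P[] ->; rewrite inE;
  exact: notin_matching BM.
have n0 : set0 \notin M by apply/negP => /(subsetP ME)/gE; rewrite cards0.
have [t nM] := trivIsetU1 d tM n0.
split; last by rewrite cardsU1 nM.
rewrite /matching t subUset sub1set xyE ME /=.
rewrite /cover big_setU1 //= -/(cover M) subUset cM andbT.
by apply/subsetP => z /set2P[] ->.
Qed.

Lemma max_matching_indep E S x y : graph E ->
  x \in S :\: cover (max_matching E S) -> y \in S :\: cover (max_matching E S) ->
  [set x; y] \notin E.
Proof.
move=> gE /setDP[xS xM] /setDP[yS yM]; apply/negP => xyE.
have [MM Mmax] := max_matchingP E S.
have [MM' c] := matchingU1 gE MM xyE xS yS xM yM.
by have := Mmax _ MM'; rewrite c ltnn.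
Qed.

Lemma matchingD1 E S M a b : graph E -> matching E S M -> [set a; b] \in M ->
  [/\ matching E S (M :\ [set a; b]), a \notin cover (M :\ [set a; b]),
      b \notin cover (M :\ [set a; b]) & cover (M :\ [set a; b]) \subset cover M].
Proof.
move=> gE /and3P[ME tM cM] abM.
have cS : cover (M :\ [set a; b]) \subset cover M.
  by apply/bigcupsP => e /setD1P[_ eM]; apply: bigcup_sup.
have ni z : z \in [set a; b] -> z \notin cover (M :\ [set a; b]).
  move=> zab; apply/bigcupP => -[e /setD1P[ne eM] ze].
  by have := trivIsetP tM _ _ eM abM ne; move/pred0P/(_ z); rewrite /= ze zab.
split=> //; [|by apply: ni; rewrite set21|by apply: ni; rewrite set22].
rewrite /matching (subset_trans (subsetDl _ _) ME) (subset_trans cS cM) andbT.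
exact: trivIsetS (subsetDl _ _) tM.
Qed.

(* Otherwise [x - a - b - y] would be an augmenting path. *)
Lemma max_matching_augment E S x y a b : graph E -> x != y ->
  x \in S :\: cover (max_matching E S) -> y \in S :\: cover (max_matching E S) ->
  [set a; b] \in max_matching E S -> [set x; a] \in E -> [set y; b] \in E -> False.
Proof.
move=> gE xy /setDP[xS xM] /setDP[yS yM] abM xaE ybE.
have [MM Mmax] := max_matchingP E S.
set M := max_matching E S in xM yM abM MM Mmax.
have [MM1 aM1 bM1 cS] := matchingD1 gE MM abM.
have [ME tM /subsetP cM] := and3P MM.
have ab : a != b by apply: nb_neq gE _; rewrite inE (subsetP ME).
have aM : a \in cover M by apply/bigcupP; exists [set a; b]; rewrite ?set21.
have bM : b \in cover M by apply/bigcupP; exists [set a; b]; rewrite ?set22.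
have xM1 := contra (subsetP cS x) xM; have yM1 := contra (subsetP cS y) yM.
have [MM2 c2] := matchingU1 gE MM1 xaE xS (cM _ aM) xM1 aM1.
have ni z : z != x -> z != a -> z \notin cover (M :\ [set a; b]) ->
    z \notin cover ([set x; a] |: M :\ [set a; b]).
  move=> zx za /negP nz; apply/bigcupP => -[e /setU1P[->|eM] ze].
    by move: ze; rewrite !inE (negPf zx) (negPf za).
  by apply: nz; apply/bigcupP; exists e.
have yx : y != x by rewrite eq_sym.
have ya : y != a by apply: contraNneq yM => ->.
have bx : b != x by apply: contraNneq xM => <-.
have ba : b != a by rewrite eq_sym.
have [MM3 c3] := matchingU1 gE MM2 ybE yS (cM _ bM) (ni _ yx ya yM1) (ni _ bx ba bM1).
by have := Mmax _ MM3; rewrite c3 c2 (cardsD1 [set a; b] M) abM add1n ltnn.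
Qed.

(** If two vertices of [S] are unmatched, all their neighbours in [S] are matched, and an edge of
    the matching receives at most two of the four possible edges from them, as there is no
    augmenting path. *)
Lemma max_matching_large E S m : graph E -> {in S, forall x, m <= #|nb E x :&: S|} ->
  m <= #|max_matching E S| \/ #|S| <= (2 * #|max_matching E S|).+1.
Proof.
move=> gE Sm; have [MM Mmax] := max_matchingP E S.
set M := max_matching E S in MM Mmax *; have [ME tM cM] := and3P MM.
case: (leqP #|S| (2 * #|M|).+1) => [|SM]; [by right | left].
have : 1 < #|S :\: cover M| by rewrite cardsD (setIidPr cM) (matching_cover gE MM); lia.
case/card_gt1P => x [y [xS yS xy]].
have sub z : z \in S :\: cover M -> nb E z :&: S = nb E z :&: cover M.
  move=> zS; apply/setP => w; rewrite !inE; case zw: (_ \in E) => //=.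
  apply/idP/idP => [wS|]; last exact: (subsetP cM).
  apply: contraTT zw => wM; apply: (max_matching_indep gE zS); exact/setDP.
have := Sm x; have := Sm y; rewrite !sub //.
have [[xS' _] [yS' _]] := (setDP xS, setDP yS) => /(_ yS') my /(_ xS') mx.
have split z : #|nb E z :&: cover M| = \sum_(e in M) #|nb E z :&: e|.
  have cnt A : #|nb E z :&: A| = \sum_(w in A | w \in nb E z) 1.
    by rewrite -sum1_card; apply: eq_bigl => w; rewrite inE andbC.
  by rewrite cnt big_trivIset_cond //; apply: eq_bigr => e _; rewrite cnt.
suff : #|nb E x :&: cover M| + #|nb E y :&: cover M| <= #|M| * 2 by lia.
rewrite !split -big_split /= -sum_nat_const; apply: leq_sum => e eM.
have [a [b [ab ee]]] := graph_pairP gE (subsetP ME _ eM).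
have co z : #|nb E z :&: e| = (a \in nb E z) + (b \in nb E z).
  rewrite ee (_ : nb E z :&: _ = [set w in [set a; b] | w \in nb E z]); last first.
    by apply/setP => w; rewrite !inE andbC.
  rewrite -sum1dep_card big_mkcondr /= big_setU1 ?inE //= big_set1.
  by rewrite !inE; do 2!case: (_ \in E).
rewrite !co !inE; rewrite ee in eM.
have n1 : ~~ (([set x; a] \in E) && ([set y; b] \in E)).
  by apply/negP => /andP[]; apply: max_matching_augment gE xy xS yS eM.
have n2 : ~~ (([set x; b] \in E) && ([set y; a] \in E)).
  by apply/negP => /andP[]; rewrite setUC in eM; apply: max_matching_augment gE xy xS yS eM.
by move: n1 n2; do 4!case: (_ \in E).
Qed.
End EdgeSets.

(** * Triangle packings *)

Section Packings.
Variable T : finType.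
Implicit Types (E M F P : {set {set T}}) (A S e : {set T}) (x y z : T).

Lemma sgraph_graph (G : sgraph T) : graph G.
Proof. by move=> e eG; apply/eqP; apply: (forall_inP (edgesP G)). Qed.

Lemma card_edges_triangle E A : graph E -> #|A| = 3 ->
  {in A &, forall x y, x != y -> [set x; y] \in E} -> #|[set e in E | e \subset A]| = 3.
Proof.
move=> gE A3 cA; have <- : 'C(#|A|, 2) = 3 by rewrite A3.
rewrite -cards_draws.
apply: eq_card => e; rewrite !inE andbC; case eA: (e \subset A) => //=.
apply/idP/eqP => [/gE // | e2].
have /cards2P[x [y [xy ee]]] : #|e| == 2 by rewrite e2.
by rewrite ee cA // (subsetP eA) // ee !inE eqxx ?orbT.
Qed.

(** Replacing the three edges of each packed triangle by the triangle saves two members of the edge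
    partition. *)
Lemma cp_packing (G : sgraph T) P : packing G P -> cp G + 2 * #|P| <= #|edges G|.
Proof.
move=> [P3 PI]; have gG := sgraph_graph (G := G).
have uniqP e A B : e \in edges G -> A \in P -> B \in P -> e \subset A -> e \subset B -> A = B.
  move=> eG AP BP eA eB; apply/eqP/negPn/negP => AB.
  have := leq_trans (subset_leq_card (introT subsetIP (conj eA eB))) (PI _ _ AP BP AB).
  by rewrite (gG _ eG).
pose U := [set e in edges G | [exists A in P, e \subset A]].
pose F := P :|: (edges G :\: U).
have cntU : 3 * #|P| <= #|U|.
  rewrite mulnC -sum_nat_const.
  rewrite (eq_bigr (fun A => #|[set e in edges G | e \subset A]|)); last first.
    by move=> A /P3[A3 cA]; rewrite card_edges_triangle.
  under eq_bigr do rewrite -sum1dep_card big_mkcondr /=.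
  rewrite exchange_big /= -sum1dep_card [leqRHS]big_mkcondr /=.
  apply: leq_sum => e eG; rewrite -big_mkcondr sum1dep_card /=.
  case: ifPn => [_|]; last first.
    rewrite negb_exists_in => /forall_inP H.
    rewrite leqn0 cards_eq0; apply/eqP/setP => A; rewrite !inE.
    by apply/negP => /andP[/H/negP].
  apply/card_le1_eqP => A B; rewrite !inE => /andP[AP eA] /andP[BP eB].
  exact: (uniqP e).
have UG : U \subset edges G by apply/subsetP => e; rewrite inE => /andP[].
have cF : #|F| + 2 * #|P| <= #|edges G|.
  have := (leq_card_setU P (edges G :\: U)).1; rewrite -/F cardsD (setIidPr UG).
  move: cntU (subset_leq_card UG); clear; lia.
suff pF : clique_partition G F by apply: leq_trans cF; rewrite leq_add2r (cpP G).2.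
have uniqF e A B : e \in edges G -> A \in F -> B \in F -> e \subset A -> e \subset B -> A = B.
  move=> eG; have sme X : X \in edges G -> e \subset X -> X = e.
    by move=> XG eX; apply/esym/eqP; rewrite eqEcard eX !gG.
  have nU X Y : X \in P -> Y \in edges G :\: U -> e \subset X -> e \subset Y -> X = Y.
    move=> XP /setDP[YG] + eX eY; rewrite (sme _ YG eY) inE eG /= negb_exists_in.
    by move/forall_inP/(_ _ XP); rewrite eX.
  move=> /setUP[AP|AD] /setUP[BP|BD] eA eB; last 1 first.
  - case/setDP: AD => AG _; case/setDP: BD => BG _.
    by rewrite (sme _ AG eA) (sme _ BG eB).
  - exact: (uniqP e).
  - exact: nU AP BD eA eB.
  - exact: esym (nU _ _ BP AD eB eA).
have covF e : e \in edges G -> exists2 A, A \in F & e \subset A.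
  move=> eG; case: (boolP (e \in U)) => [|eU]; last by exists e; rewrite // in_setU in_setD eU eG orbT.
  by rewrite inE eG => /exists_inP[A AP eA]; exists A; rewrite // inE AP.
apply/andP; split; first (apply/andP; split).
- apply/forall_inP => A /setUP[/P3[_ cA]|/setDP[AG _]].
    by apply/forall_inP => x xA; apply/forall_inP => y yA; apply/implyP; apply: cA.
  apply/forall_inP => x xA; apply/forall_inP => y yA; apply/implyP => xy.
  have /andP[/andP[/forall_inP/(_ _ AG) cl _] _] := edges_clique_partition G.
  by move/forall_inP/(_ _ xA)/forall_inP/(_ _ yA)/implyP: cl => /(_ xy).
- by apply/forall_inP => e /covF[A AF eA]; apply/exists_inP; exists A.
- apply/forall_inP => e eG; have [A AF eA] := covF _ eG.
  apply/cards1P; exists A; apply/setP => B; rewrite in_set1 in_set.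
  apply/andP/eqP => [[BF eB]|-> //]; exact: uniqF eG BF AF eB eA.
Qed.

Definition del_vertex_matching E v M := E :\: star E v :\: M.

Lemma card_del_vertex_matching E v M : graph E -> matching E (nb E v) M ->
  #|E| = #|del_vertex_matching E v M| + #|nb E v| + #|M|.
Proof.
move=> gE MM; have [ME _ /subsetP cM] := and3P MM.
have sE : star E v \subset E by apply/subsetP => e; rewrite inE => /andP[].
have MD : M \subset E :\: star E v.
  apply/subsetP => e eM; rewrite !inE (subsetP ME) //= andbT; apply/negP => ve.
  have /cM vv : v \in cover M by apply/bigcupP; exists e.
  by have := nb_neq gE vv; rewrite eqxx.
have := cardsD (E :\: star E v) M; rewrite (setIidPr MD) => c1.
have := cardsD E (star E v); rewrite (setIidPr sE) card_star // => c2.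
have := subset_leq_card sE; have := subset_leq_card MD.
rewrite /del_vertex_matching c1 c2 card_star //; clear; lia.
Qed.

(** No triangle of [P] contains [v] or an edge of [M], because those edges are deleted; the new
    triangles [v |: e] meet one another only in [v]. *)
Lemma packing_del_vertex_matching E v M P : graph E -> matching E (nb E v) M ->
  packing (del_vertex_matching E v M) P ->
  exists2 Q, packing E Q & #|Q| = #|P| + #|M|.
Proof.
move=> gE MM [P3 PI]; have [/subsetP ME tM /subsetP cM] := and3P MM.
have vnv : v \notin nb E v by apply/negP => /(nb_neq gE); rewrite eqxx.
have enb e x : e \in M -> x \in e -> x \in nb E v.
  by move=> eM xe; apply: cM; apply/bigcupP; exists e.
have ve e : e \in M -> v \notin e.
  by move=> eM; apply/negP => /(enb _ _ eM); apply/negP.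
have vP A : A \in P -> v \notin A.
  move=> AP; have [A3 cA] := P3 _ AP; apply/negP => vA.
  have : A :\ v != set0 by rewrite -card_gt0; have := cardsD1 v A; rewrite vA A3; lia.
  case/set0Pn => y /setD1P[yv yA]; have := cA _ _ vA yA; rewrite eq_sym => /(_ yv).
  by rewrite !inE eqxx /= andbT; case: (_ \in E); rewrite ?andbF.
have eP A e : A \in P -> e \in M -> ~~ (e \subset A).
  move=> AP eM; apply/negP => eA; have [A3 cA] := P3 _ AP.
  have [x [y [xy ee]]] := graph_pairP gE (ME _ eM).
  have := cA x y; rewrite -ee !(subsetP eA) ?ee ?set21 ?set22 // -ee => /(_ erefl erefl xy).
  by rewrite !inE eM.
pose N := [set v |: e | e in M].
have PN A B : A \in P -> B \in N -> #|A :&: B| <= 1.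
  move=> AP /imsetP[e eM ->].
  have -> : A :&: (v |: e) = A :&: e.
    apply/setP => x; rewrite !inE; case xA: (x \in A) => //=.
    by case: eqP => // xv; move: (vP _ AP); rewrite -xv xA.
  rewrite leqNgt; apply/negP => c; have /negP[] := eP _ _ AP eM.
  have /eqP <- : A :&: e == e by rewrite eqEcard subsetIr (gE _ (ME _ eM)).
  exact: subsetIl.
have NN A B : A \in N -> B \in N -> A != B -> #|A :&: B| <= 1.
  move=> /imsetP[e eM ->] /imsetP[f fM ->] ef.
  have ne : e != f by apply: contraNneq ef => ->.
  have d := trivIsetP tM _ _ eM fM ne.
  rewrite -[leqRHS](cards1 v); apply: subset_leq_card; apply/subsetP => x.
  rewrite !inE; case: eqP => //= _ /andP[xe xf].
  by move/pred0P/(_ x): d; rewrite /= xe xf.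
have cN : #|N| = #|M|.
  apply: card_in_imset => e f eM fM ef.
  by rewrite -(setU1K (ve _ eM)) ef setU1K // ve.
have dPN : [disjoint P & N].
  rewrite disjoint_subset; apply/subsetP => A AP; rewrite inE; apply/negP => /imsetP[e _ Ae].
  by have := vP _ AP; rewrite Ae setU11.
exists (P :|: N); last by rewrite cardsU disjoint_setI0 // cards0 subn0 cN.
split.
  move=> A /setUP[/P3[A3 cA]|/imsetP[e eM ->]].
    by split=> // x y xA yA xy; have := cA _ _ xA yA xy; rewrite !inE => /and3P[].
  split; first by rewrite cardsU1 ve // (gE _ (ME _ eM)).
  have ge := gE _ (ME _ eM).
  have vx x : x \in e -> [set v; x] \in E by move=> /(enb _ _ eM); rewrite inE.
  move=> x y /setU1P[->|xe] /setU1P[->|ye]; rewrite ?eqxx // => xy; last 1 first.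
  - suff -> : [set x; y] = e by apply: ME.
    apply/eqP; rewrite eqEcard ge cards2 xy andbT.
    by apply/subsetP => z /set2P[] ->.
  - exact: vx.
  - by rewrite setUC; apply: vx.
move=> A B /setUP[AP|AN] /setUP[BP|BN] AB; [exact: PI|exact: PN| |exact: NN].
by rewrite setIC; apply: PN.
Qed.

End Packings.

(** * Minimum degree elimination *)

Lemma sum_half n : \sum_(i < n) (n - i)./2 = n ^ 2 %/ 4.
Proof.
elim: n => [|n IH]; first by rewrite big_ord0.
rewrite big_ord_recl subn0; under eq_bigr do rewrite /= /bump add1n subSS.
rewrite IH -[n]odd_double_half; move: (n./2) (odd n) => m [] /=.
  have -> : (true + m.*2).+1 ^ 2 = (m * m + 2 * m + 1) * 4 by lia.
  have -> : (true + m.*2) ^ 2 = (m * m + m) * 4 + 1 by lia.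
  by rewrite mulnK // divnMDl //; lia.
have -> : (false + m.*2).+1 ^ 2 = (m * m + m) * 4 + 1 by lia.
have -> : (false + m.*2) ^ 2 = (m * m) * 4 by lia.
by rewrite mulnK // divnMDl //; lia.
Qed.

Section Elimination.
Variables (T : finType) (x0 : T) (E0 : {set {set T}}).
Hypothesis gE0 : graph E0.
Implicit Types (V S e : {set T}) (E : {set {set T}}) (i j : nat).

(** The default [x0] is returned for empty [V] only. *)
Definition min_degree_vertex V E : T :=
  odflt x0 [pick v in V | [forall u in V, #|nb E v| <= #|nb E u|]].

Lemma min_degree_vertexP V E : V != set0 ->
  min_degree_vertex V E \in V /\ {in V, forall u, #|nb E (min_degree_vertex V E)| <= #|nb E u|}.
Proof.
case/set0Pn => y yV; rewrite /min_degree_vertex; case: pickP => [v /andP[vV /forall_inP vm]|H].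
  by split.
case: (@arg_minnP _ y (mem V) (fun v => #|nb E v|) yV) => v vV vm.
by have /negP[] := negbT (H v); apply/andP; split=> //; apply/forall_inP.
Qed.

Definition elim_step (s : {set T} * {set {set T}}) :=
  let v := min_degree_vertex s.1 s.2 in
  (s.1 :\ v, del_vertex_matching s.2 v (max_matching s.2 (nb s.2 v))).

Definition Vs i := (iter i elim_step ([set: T], E0)).1.
Definition Es i := (iter i elim_step ([set: T], E0)).2.
Definition vs i := min_degree_vertex (Vs i) (Es i).
Definition Ns i := nb (Es i) (vs i).
Definition Ms i := max_matching (Es i) (Ns i).
(** Independent in [Es i], because the matching is maximum. *)
Definition Is i := Ns i :\: cover (Ms i).

Lemma VsS i : Vs i.+1 = Vs i :\ vs i. Proof. by []. Qed.

Lemma EsS i : Es i.+1 = del_vertex_matching (Es i) (vs i) (Ms i). Proof. by []. Qed.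

Lemma EsSsub i : Es i.+1 \subset Es i.
Proof. by rewrite EsS /del_vertex_matching !(subset_trans (subsetDl _ _)). Qed.

Lemma Es_sub i j : i <= j -> Es j \subset Es i.
Proof.
move=> /subnKC <-; elim: (j - i) => [|m IH]; first by rewrite addn0.
by rewrite addnS (subset_trans (EsSsub _)).
Qed.

Lemma Vs_sub i j : i <= j -> Vs j \subset Vs i.
Proof.
move=> /subnKC <-; elim: (j - i) => [|m IH]; first by rewrite addn0.
by rewrite addnS VsS (subset_trans (subsetDl _ _)).
Qed.

Lemma graph_Es i : graph (Es i).
Proof. exact: graphS (Es_sub (leq0n i)) gE0. Qed.

Lemma Ms_matching i : matching (Es i) (Ns i) (Ms i).
Proof. exact: (max_matchingP _ _).1. Qed.

Lemma Es_Vs i e : e \in Es i -> e \subset Vs i.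
Proof.
elim: i => [|i IH]; first by rewrite subsetT.
rewrite EsS VsS !inE => /and3P[_ + eE]; rewrite eE /= => ve.
by rewrite subsetD1 IH.
Qed.

Lemma Vs_card_vs i : i <= #|T| -> #|Vs i| = #|T| - i /\ (i < #|T| -> vs i \in Vs i).
Proof.
elim: i => [|i IH] iT.
  by rewrite subn0 cardsT; split=> // T0; apply: (min_degree_vertexP _ _).1; rewrite -card_gt0 cardsT.
have [cV vV] := IH (ltnW iT); have := cardsD1 (vs i) (Vs i); rewrite (vV iT) -VsS cV => cV'.
have c : #|Vs i.+1| = #|T| - i.+1 by move: cV' iT; clear; lia.
split=> // lt; apply: (min_degree_vertexP _ _).1.
by rewrite -card_gt0 c subn_gt0.
Qed.

Lemma card_Vs i : i <= #|T| -> #|Vs i| = #|T| - i.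
Proof. by case/Vs_card_vs. Qed.

Lemma vs_Vs i : i < #|T| -> vs i \in Vs i.
Proof. by move=> iT; case: (Vs_card_vs (ltnW iT)) => _; apply. Qed.

Lemma vs_min i u : i < #|T| -> u \in Vs i -> #|Ns i| <= #|nb (Es i) u|.
Proof.
move=> iT uV; apply: (min_degree_vertexP _ _).2 uV.
by apply/set0Pn; exists (vs i); apply: vs_Vs.
Qed.

Lemma vs_neq i j : i < j -> j < #|T| -> vs i != vs j.
Proof.
move=> ij jT; have := subsetP (Vs_sub ij) _ (vs_Vs jT); rewrite VsS.
by rewrite eq_sym => /setD1P[].
Qed.

Lemma Ns_Vs i : Ns i \subset Vs i :\ vs i.
Proof.
apply/subsetP => u uN; have := uN; rewrite inE => /Es_Vs /subsetP/(_ u (set22 _ _)) uV.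
by rewrite !inE uV andbT eq_sym (nb_neq (@graph_Es i) uN).
Qed.

Lemma cover_Ms i : cover (Ms i) \subset Ns i.
Proof. by case/and3P: (Ms_matching i). Qed.

Lemma card_cover_Ms i : #|cover (Ms i)| = 2 * #|Ms i|.
Proof. exact: matching_cover (@graph_Es i) (Ms_matching i). Qed.

Lemma card_Is i : #|Is i| + 2 * #|Ms i| = #|Ns i|.
Proof.
rewrite -card_cover_Ms cardsD (setIidPr (cover_Ms i)) subnK //.
exact: subset_leq_card (cover_Ms i).
Qed.

Lemma Is_indep i x y : x \in Is i -> y \in Is i -> [set x; y] \notin Es i.
Proof. exact: max_matching_indep (@graph_Es i). Qed.

Lemma card_Es i : #|Es i| = #|Es i.+1| + #|Ns i| + #|Ms i|.
Proof. exact: card_del_vertex_matching (@graph_Es i) (Ms_matching i). Qed.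

(** An edge at a removed vertex no longer lies inside [Vs i], so only a matching can have taken
    [e]. *)
Lemma Es_deleted i e : e \in E0 -> e \subset Vs i -> e \notin Es i ->
  exists2 j, j < i & e \in Ms j.
Proof.
move=> eE0; elim: i => [|i IH]; first by rewrite eE0.
rewrite VsS EsS subsetD1 => /andP[eV ve]; rewrite !inE (negPf ve) andbF /=.
case: (boolP (e \in Es i)) => [_|eE _]; last by have [j ji ej] := IH eV eE; exists j => //; apply: ltnW.
by rewrite andbT negbK => eM; exists i.
Qed.

(** With [r = #|T| - i] vertices left and minimum degree [d], each neighbour of [vs i] has at least
    [2 d - r] neighbours inside [Ns i], so [max_matching_large] applies. *)
Lemma Ns_dense i : i < #|T| -> 2 * #|Ns i| <= #|T| - i + #|Ms i| \/ #|Ns i| <= (2 * #|Ms i|).+1.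
Proof.
move=> iT; have cV := card_Vs (ltnW iT).
have := @max_matching_large _ (Es i) (Ns i) (2 * #|Ns i| - (#|T| - i)) (@graph_Es i).
case=> [u uN| |]; [|rewrite -/(Ms i); clear; lia|by right].
have uV := subsetP (subset_trans (Ns_Vs i) (subsetDl _ _)) _ uN.
have nV w : nb (Es i) w \subset Vs i.
  by apply/subsetP => z; rewrite inE => /Es_Vs/subsetP; apply; apply: set22.
have := cardsUI (nb (Es i) u) (Ns i); have := vs_min iT uV.
have : #|nb (Es i) u :|: Ns i| <= #|Vs i|.
  by apply: subset_leq_card; rewrite subUset !nV.
rewrite cV; clear; lia.
Qed.

Lemma Ns_lt i : i < #|T| -> #|Ns i| < #|T| - i.
Proof.
move=> iT; have := subset_leq_card (Ns_Vs i).
have := cardsD1 (vs i) (Vs i); rewrite (vs_Vs iT) (card_Vs (ltnW iT)); clear; lia.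
Qed.

(** This makes the truncated subtraction in [gain] exact. *)
Lemma Ns_le i : i < #|T| -> #|Ns i| <= (#|T| - i)./2 + #|Ms i|.
Proof.
move=> iT; have := Ns_lt iT; case: (Ns_dense iT); clear; lia.
Qed.

(* The number of members saved at step [i] in comparison with the share
   [(#|T| - i)./2] of that step in [#|T| ^ 2 %/ 4]. *)
Definition gain i := (#|T| - i)./2 + #|Ms i| - #|Ns i|.

Lemma gainE i : i < #|T| -> #|Ns i| + gain i = (#|T| - i)./2 + #|Ms i|.
Proof. by move=> /Ns_le H; rewrite /gain subnKC. Qed.

Lemma Es_card : Es #|T| = set0.
Proof.
apply/setP => e; rewrite inE; apply/negP => eE; have := Es_Vs eE.
have := card_Vs (leqnn #|T|); rewrite subnn => /cards0_eq ->; rewrite subset0 => /eqP e0.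
by have := graph_Es eE; rewrite e0 cards0.
Qed.

Lemma elimination_packing : exists2 P, packing E0 P & #|P| = \sum_(i < #|T|) #|Ms i|.
Proof.
(* Induction on the number [m] of steps still to come. *)
have H m : m <= #|T| -> exists2 P, packing (Es (#|T| - m)) P & #|P| = \sum_(#|T| - m <= i < #|T|) #|Ms i|.
  elim: m => [|m IH] mT.
    by rewrite subn0 Es_card; exists set0; [split=> A; rewrite inE|rewrite big_geq // cards0].
  have [P] := IH (ltnW mT); rewrite -(subnSK mT) EsS.
  move=> /(packing_del_vertex_matching (@graph_Es _) (Ms_matching _))[Q QP cQ] cP.
  exists Q => //; rewrite cQ cP [RHS]big_ltn 1?addnC //; move: mT; clear; lia.
by have := H _ (leqnn _); rewrite subnn big_mkord.
Qed.

(** Sums [gainE] over all steps; step [i] deletes [#|Ns i| + #|Ms i|] edges. *)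
Lemma sum_gain : #|E0| + \sum_(i < #|T|) gain i = #|T| ^ 2 %/ 4 + 2 * \sum_(i < #|T|) #|Ms i|.
Proof.
have -> : #|E0| = \sum_(i < #|T|) (#|Ns i| + #|Ms i|).
  have H m : #|E0| = #|Es m| + \sum_(i < m) (#|Ns i| + #|Ms i|).
    elim: m => [|m IH]; first by rewrite big_ord0 addn0.
    by rewrite IH card_Es big_ord_recr /=; clear; lia.
  by rewrite (H #|T|) Es_card cards0.
rewrite -sum_half -big_split /= mul2n -addnn addnA -!big_split /=.
by apply: eq_bigr => i _; rewrite addnAC gainE.
Qed.

(** Let [r = #|T| - i] and [d = #|Ns i|]. In the first case of [Ns_dense] the gain is at least about
    [#|Ms i| / 2]. In the second it could vanish for [d] near [r], as in complete graphs; sparsity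
    forces [8 d <= 7 r], and the gain is then at least about [#|Ms i| / 7]. *)
Lemma gain_small i : 0 < #|T| -> 7 * #|E0| < 3 * #|T| ^ 2 -> 128 * i <= #|T| ->
  #|Ms i| <= 7 * gain i + 7.
Proof.
move=> T0 sE iT.
have iT' : i < #|T| by move: iT T0; clear; lia.
have deg : #|Ns i| * (#|T| - i) <= 2 * #|E0|.
  apply: leq_trans (_ : 2 * #|Es i| <= _); last by rewrite leq_mul2l subset_leq_card // (Es_sub (leq0n i)).
  rewrite -(handshake (@graph_Es i)) -(card_Vs (ltnW iT')) mulnC -sum_nat_const.
  rewrite [leqRHS](bigID (mem (Vs i))) /=; apply: (leq_trans _ (leq_addr _ _)).
  by apply: leq_sum => u; apply: vs_min.
(* From [d r < 6/7 n^2] and [128 r >= 127 n], since [6/7 * (128/127)^2 < 7/8]. *)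
have d8 : 8 * #|Ns i| <= 7 * (#|T| - i).
  move: deg sE iT; set d := #|Ns i|; set m := #|E0|; set n := #|T| => H1 H2 H3; clearbody d m n; clear -H1 H2 H3.
  rewrite leqNgt; apply/negP => H4; have : 7 * (n - i) * (n-i) <= 8 * d * (n - i) by nia.
  have : 127 * n <= 128 * (n - i) by lia.
  move: (n - i) H1 H4 => r H1 H4 H5 H6.
  have : 127 * n * (127 * n) <= 128 * r * (128 * r) by nia.
  nia.
have := gainE iT'; have := Ns_dense iT'; have := Ns_le iT'.
move: d8; move: (gain i) #|Ms i| #|Ns i|; clear -iT'; lia.
Qed.

End Elimination.

Lemma cp_gain (T : finType) (x0 : T) (G : sgraph T) :
  cp G + \sum_(i < #|T|) gain x0 (edges G) i <= #|T| ^ 2 %/ 4.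
Proof.
have gG := sgraph_graph (G := G).
have [P /cp_packing cpP PM] := elimination_packing x0 gG.
have := sum_gain x0 gG; move: cpP; rewrite PM.
move: (\sum_(i < _) gain _ _ _) (\sum_(i < _) #|_|) #|edges G| (_ %/ 4).
clear; lia.
Qed.

(** * Counting cross edges *)

Lemma card_le_cover (I J : finType) (Z : {set I}) (F : {set J}) (R : J -> {set I}) m :
  {in Z, forall z, exists2 j, j \in F & z \in R j} ->
  {in F, forall j, #|Z :&: R j| <= m} -> #|Z| <= #|F| * m.
Proof.
move=> ZF Fm; apply: leq_trans (_ : \sum_(j in F) #|Z :&: R j| <= _); last first.
  by rewrite -sum_nat_const; apply: leq_sum.
under eq_bigr do rewrite -sum1dep_card big_mkcondr /=.
rewrite exchange_big /= -sum1_card; apply: leq_sum => z /ZF[j jF zj].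
by rewrite (bigD1 j) //= zj.
Qed.

Lemma card_offdiag (T : finType) (S : {set T}) :
  #|[set p in setX S S | p.1 != p.2]| + #|S| = #|S| * #|S|.
Proof.
have dg : [set q in setX S S | q.1 == q.2] = [set (x, x) | x in S].
  apply/setP => -[x y]; rewrite in_set in_setX /=.
  apply/andP/imsetP => [[/andP[xp _] /eqP <-]|[w wp [-> ->]]]; first by exists x.
  by rewrite wp eqxx.
rewrite -cardsX -(cardsID [set q | q.1 == q.2] (setX S S)) -setIdE dg addnC.
congr (_ + _); first by rewrite card_imset // => ? ? [].
by apply: eq_card => q; rewrite !inE andbC.
Qed.

Section CoverLowerBound.
Variables (T : finType) (G : sgraph T).
Implicit Types (X Y Q : {set T}).

Definition edges_in (E : {set {set T}}) X := [set e in E | e \subset X].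

Lemma nb_edges_in E X x : x \in X -> nb (edges_in E X) x = nb E x :&: X.
Proof.
move=> xX; apply/setP => y; rewrite !inE; case: (_ \in E) => //=.
by rewrite subUset !sub1set xX.
Qed.

(** The trace of a clique on [X] lies in the closed neighbourhood of [x] within [X]. *)
Lemma card_clique_part Q X K x : clique G Q -> x \in Q :&: X ->
  #|nb (edges_in (edges G) X) x| <= K -> #|Q :&: X| <= K.+1.
Proof.
move=> /forall_inP cQ xQX; case/setIP: (xQX) => xQ xX; rewrite nb_edges_in // => d.
rewrite (cardsD1 x) xQX ltnS; apply: leq_trans d; apply: subset_leq_card.
apply/subsetP => y; rewrite !inE => /and3P[yx yQ yX]; rewrite yX andbT.
by move/forall_inP/(_ _ yQ)/implyP: (cQ _ xQ); apply; rewrite eq_sym.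
Qed.

(* At most [2 * B / K.+1] vertices on each side have more than [K] neighbours
   on their own side; a clique covers at most [K.+1 ^ 2] of the cross edges
   that avoid these vertices. *)
Lemma cross_edges_le_cc X Y B K :
  #|edges_in (edges G) X| <= B -> #|edges_in (edges G) Y| <= B ->
  K.+1 * (\sum_(x in X) #|nb (edges G) x :&: Y|) <= 4 * B * #|T| + cc G * K.+1 ^ 3.
Proof.
move=> XB YB; have gG := sgraph_graph (G := G).
pose high X := [set x | K < #|nb (edges_in (edges G) X) x|].
have cardH Z : #|edges_in (edges G) Z| <= B -> #|high Z| * K.+1 <= 2 * B.
  move=> ZB; apply: leq_trans (card_high _ _) _; last by rewrite leq_mul2l.
  by apply: graphS gG; apply/subsetP => e; rewrite inE => /andP[].
pose Z := [set p : T * T | [&& p.1 \in X, p.2 \in Y & [set p.1; p.2] \in edges G]].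
have -> : \sum_(x in X) #|nb (edges G) x :&: Y| = #|Z|.
  under eq_bigr do rewrite -sum1_card; rewrite pair_big_dep /= sum1dep_card.
  by apply: eq_card => p; rewrite !inE; congr (_ && _); rewrite andbC.
pose Z' := Z :\: (setX (high X) setT :|: setX setT (high Y)).
have ZZ' : #|Z| <= #|Z'| + (#|high X| * #|T| + #|T| * #|high Y|).
  rewrite -(cardsID (setX (high X) setT :|: setX setT (high Y)) Z) addnC leq_add2l.
  apply: leq_trans (subset_leq_card (subsetIr _ _)) _.
  apply: leq_trans (leq_card_setU _ _).1 _.
  by rewrite !cardsX cardsT.
have [[F /andP[/forall_inP Fc /forall_inP Fe] <-] _] := ccP G.
have cZ' : #|Z'| <= #|F| * (K.+1 * K.+1).
  apply: (@card_le_cover _ _ _ _ (fun Q => setX Q Q)) => [[x y]|Q QF].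
    rewrite !inE => /andP[_ /and3P[_ _ /Fe/exists_inP[Q QF]]].
    by rewrite subUset !sub1set => /andP[xQ yQ]; exists Q; rewrite // !inE xQ.
  have [->|[[x y]]] := set_0Vmem (Z' :&: setX Q Q); first by rewrite cards0.
  rewrite !inE /= andbT negb_or -!leqNgt => /and3P[/andP[/andP[hx hy] /and3P[xX yY _]] xQ yQ].
  apply: leq_trans (_ : #|setX (Q :&: X) (Q :&: Y)| <= _).
    apply: subset_leq_card; apply/subsetP => -[a b]; rewrite !inE /=.
    by move=> /and3P[/andP[_ /and3P[-> -> _]] -> ->].
  rewrite cardsX leq_mul //.
    by apply: card_clique_part hx; rewrite ?Fc // inE xQ.
  by apply: card_clique_part hy; rewrite ?Fc // inE yQ.
have := cardH _ XB; have := cardH _ YB.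
move: ZZ' cZ'; move: #|F| #|Z'| #|Z| #|high X| #|high Y| #|T| => f z' z a b n; clear.
move=> H1 H2 H3 H4; rewrite !expnS expn0; nia.
Qed.

End CoverLowerBound.

(** * Triangle packings in dense graphs *)

Section Dense.
Import GRing.Theory.
Local Open Scope ring_scope.

(* The triples of distinct residues with sum zero form a partial triple system
   of nearly full size, each pair being completed by [- x - y]. *)
Lemma dense_packing n (E : {set {set 'I_n.+1}}) : graph E ->
  exists2 P, packing E P & (3 * #|E| <= n.+1 ^ 2 + 3 * #|P|)%N.
Proof.
move=> gE; pose z (p : 'I_n.+1 * 'I_n.+1) := - p.1 - p.2.
pose tri p := [set p.1; p.2; z p].
pose adj := [set p : 'I_n.+1 * 'I_n.+1 | p.2 \in nb E p.1].
pose f (p : 'I_n.+1 * 'I_n.+1) := (p.1, z p).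
pose g (p : 'I_n.+1 * 'I_n.+1) := (p.2, z p).
have injf : injective f.
  move=> [a b] [c d] H; have /= ac : a = c := congr1 fst H.
  have e : - a - b = - c - d := congr1 snd H.
  by rewrite ac in e *; rewrite (oppr_inj (addrI _ e)).
have injg : injective g.
  move=> [a b] [c d] H; have /= bd : b = d := congr1 fst H.
  have e : - a - b = - c - d := congr1 snd H.
  by rewrite bd in e *; rewrite (oppr_inj (addIr _ e)).
(* All three pairs of the triple must be edges. Each condition holds for [#|adj|] of the [n.+1 ^ 2]
   ordered pairs, since [f] and [g] are injective. *)
pose good := adj :&: f @^-1: adj :&: g @^-1: adj.
have cadj : #|adj| = (2 * #|E|)%N.
  rewrite -handshake //; under [RHS]eq_bigr do rewrite -sum1_card.
  by rewrite pair_big_dep /= sum1dep_card.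
have cgood : (3 * #|adj| <= #|good| + 2 * n.+1 ^ 2)%N.
  have c1 := card_preimset adj injf; have c2 := card_preimset adj injg.
  have u1 : (#|adj :|: f @^-1: adj| <= n.+1 ^ 2)%N.
    by apply: leq_trans (max_card _) _; rewrite card_prod card_ord mulnn.
  have u2 : (#|(adj :&: f @^-1: adj) :|: g @^-1: adj| <= n.+1 ^ 2)%N.
    by apply: leq_trans (max_card _) _; rewrite card_prod card_ord mulnn.
  have := cardsUI adj (f @^-1: adj); have := cardsUI (adj :&: f @^-1: adj) (g @^-1: adj).
  rewrite c1 c2 -/good; move: u1 u2; set u := #|_|; set v := #|_|.
  by move: #|adj| #|_ :&: _| #|good| (n.+1 ^ 2)%N u v; clear; lia.
pose P := [set tri p | p in good].
have neq p : p \in good -> [/\ p.1 != p.2, p.1 != z p & p.2 != z p].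
  rewrite !inE => /andP[/andP[a b] c].
  by split; [apply: (nb_neq gE (x := p.1))|apply: (nb_neq gE (x := p.1))|apply: (nb_neq gE (x := p.2))]; rewrite inE.
(* Any two members determine the triple, so distinct triples share at most one vertex. *)
have trisum p x y : x \in tri p -> y \in tri p -> x != y -> tri p = [set x; y; - x - y].
  case: p => a b; rewrite /tri /=; have : - a - b = z (a, b) by [].
  move: (z _) => c e1.
  have e2 : - a - c = b by rewrite -e1 opprB addrCA subrr addr0.
  have e3 : - b - c = a by rewrite -e1 opprB addrA addNr add0r opprK.
  have e4 : - b - a = c by rewrite addrC.
  have e5 : - c - a = b by rewrite addrC.
  have e6 : - c - b = a by rewrite addrC.
  rewrite !inE => /orP[/orP[]|] /eqP -> /orP[/orP[]|] /eqP ->; rewrite ?eqxx // => _;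
    rewrite ?e1 ?e2 ?e3 ?e4 ?e5 ?e6; apply/setP => w; rewrite !inE;
    by case: (w == a); case: (w == b); case: (w == c).
have tri3 p : p \in good -> #|tri p| = 3%N.
  move=> /neq[n1 n2 n3]; rewrite /tri setUC cardsU1 cards2 n1 !inE negb_or.
  by rewrite ![z p == _]eq_sym n2 n3.
exists P.
  split.
    move=> A /imsetP[p pg ->]; split; first exact: tri3.
    move: (pg); rewrite !inE => /andP[/andP[a b] c] x y; rewrite !inE.
    have [E1 E2 E3] : [/\ [set p.2; p.1] \in E, [set z p; p.1] \in E & [set z p; p.2] \in E].
      by split; rewrite setUC.
    by move=> /orP[/orP[]|] /eqP -> /orP[/orP[]|] /eqP -> //; rewrite eqxx.
  move=> A B /imsetP[p pg ->] /imsetP[q qg ->] pq; rewrite leqNgt; apply/negP.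
  move=> /card_gt1P[x [y [/setIP[xp xq] /setIP[yp yq] xy]]].
  by rewrite (trisum p x y) // (trisum q x y) ?eqxx in pq.
(* A triple comes from at most six ordered pairs. *)
have : (#|good| <= #|P| * 6)%N.
  apply: (@card_le_cover _ _ _ _ (fun A => [set p in setX A A | p.1 != p.2])) => [p pg|A].
    exists (tri p); first by apply/imsetP; exists p.
    have [n1 _ _] := neq _ pg; by rewrite !inE n1 !eqxx ?orbT.
  move=> /imsetP[p pg ->].
  have := subset_leq_card (subsetIr good [set q in setX (tri p) (tri p) | q.1 != q.2]).
  have := card_offdiag (tri p); rewrite tri3 //; clear; lia.
move: cgood; rewrite cadj.
by move: #|good| #|E| #|P| (n.+1 ^ 2)%N; clear; lia.
Qed.

End Dense.

(** * Clique partitions across a complete cut *)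

Section PartitionLowerBound.
Variables (T : finType) (G : sgraph T) (A : {set T}).

(* A part with [s] vertices in [A] and [t] outside covers [s * t] cross edges,
   and [s * t - 1 <= s * (s - 1) + t * (t - 1)]. *)
Lemma cross_edges_le_cp : {in A & ~: A, forall x y, [set x; y] \in edges G} ->
  #|A| * #|~: A| <= cp G + #|[set p : T * T | (p.2 \in nb (edges G) p.1) && ((p.1 \in A) == (p.2 \in A))]|.
Proof.
move=> AG; set U := [set p | _].
have [[F /andP[/andP[/forall_inP Fc /forall_inP Fe] /forall_inP F1] <-] _] := cpP G.
rewrite -cardsX; pose Z := setX A (~: A).
have cntZ : #|Z| <= \sum_(Q in F) #|Z :&: setX Q Q|.
  under eq_bigr do rewrite -sum1dep_card big_mkcondr /=.
  rewrite exchange_big /= -sum1_card; apply: leq_sum => -[x y]; rewrite in_setX => /andP[xA yA].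
  have /exists_inP[Q QF] := Fe _ (AG _ _ xA yA); rewrite subUset !sub1set => xyQ.
  by rewrite (bigD1 Q) //= in_setX xyQ.
(* Different parts contain disjoint sets of ordered inner pairs, as every edge lies in just one
   part. *)
have cntU : \sum_(Q in F) #|U :&: setX Q Q| <= #|U|.
  under eq_bigr do rewrite -sum1dep_card big_mkcondr /=.
  rewrite exchange_big /= -sum1_card; apply: leq_sum => -[x y]; rewrite 2!inE /= => /andP[xyE _].
  rewrite -big_mkcondr sum1dep_card /= -(eqP (F1 _ xyE)); apply/eq_leq/eq_card => Q.
  by rewrite !inE subUset !sub1set.
apply: leq_trans cntZ _; rewrite -[#|F|]muln1 -sum_nat_const.
apply: leq_trans (_ : \sum_(Q in F) (1 + #|U :&: setX Q Q|) <= _); last first.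
  by rewrite big_split leq_add2l.
apply: leq_sum => Q QF; pose off S := [set p : T * T in setX S S | p.1 != p.2].
have offU : #|off (Q :&: A)| + #|off (Q :\: A)| <= #|U :&: setX Q Q|.
  have -> : #|off (Q :&: A)| + #|off (Q :\: A)| = #|off (Q :&: A) :|: off (Q :\: A)|.
    have off0 : off (Q :&: A) :&: off (Q :\: A) = set0.
      by apply/setP => p; rewrite !inE /=; case: (p.1 \in A); rewrite /= ?andbF.
    by rewrite cardsU off0 cards0 subn0.
  apply: subset_leq_card; apply/subsetP => -[x y].
  have cQ : x \in Q -> y \in Q -> x != y -> [set x; y] \in edges G.
    by move=> xQ yQ; move: (forall_inP (forall_inP (Fc _ QF) _ xQ) _ yQ) => /implyP.
  rewrite !inE /=; move: cQ; case: (x \in Q); case: (y \in Q); case: (x \in A); case: (y \in A);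
    rewrite /= ?andbF ?orbF ?andbT //=; exact.
have <- : setX (Q :&: A) (Q :\: A) = Z :&: setX Q Q.
  by apply/setP => -[x y]; rewrite !inE /=; do 4!case: (_ \in _).
have := card_offdiag (Q :&: A); have := card_offdiag (Q :\: A); rewrite -!/(off _).
rewrite cardsX; move: offU.
move: #|U :&: _| #|off (Q :&: A)| #|off (Q :\: A)| #|Q :&: A| #|Q :\: A|.
clear => u a b s t H1 H2 H3.
(* Twice [s^2 + t^2 + 1 - s t - s - t] equals [(s - t)^2 + (s - 1)^2 + (t - 1)^2]. *)
have := (nat_Cauchy s t).1; have := (nat_Cauchy s 1).1; have := (nat_Cauchy t 1).1.
by rewrite !expnS !expn0; lia.
Qed.

End PartitionLowerBound.

(** * The lower bound *)

Section BlockGraph.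
Variables (n k : nat).
Hypothesis k0 : 0 < k.

(** Blocks are runs of [k] consecutive numbers. One that straddles the midpoint does no harm, as
    vertices of different halves are adjacent anyway. *)
Definition block_rel (x y : 'I_n) := ((x < n./2) != (y < n./2)) || (x %/ k == y %/ k).

Definition block_edges : {set {set 'I_n}} :=
  [set e : {set 'I_n} | (#|e| == 2) && [forall x in e, forall y in e, block_rel x y]].

Fact block_edgesP : [forall e in block_edges, #|e| == 2].
Proof. by apply/forall_inP => e; rewrite inE => /andP[]. Qed.

Definition block_graph := SGraph block_edgesP.

Lemma block_relC x y : block_rel x y = block_rel y x.
Proof. by rewrite /block_rel eq_sym [in X in _ || X]eq_sym. Qed.

Lemma block_pair x y : ([set x; y] \in edges block_graph) = (x != y) && block_rel x y.
Proof.
rewrite inE cards2; case: (x != y) => //=; apply/forall_inP/idP => [H|H u].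
  by apply: (forall_inP (H x _)); rewrite !inE eqxx ?orbT.
have rr z : block_rel z z by rewrite /block_rel !eqxx orbT.
by rewrite !inE => /orP[] /eqP ->; apply/forall_inP => v; rewrite !inE => /orP[] /eqP ->; rewrite // block_relC.
Qed.

(** Each clique joins a block of the lower half to a block of the upper half; this covers the edges
    inside the halves as well. The successor allows for a last incomplete block. *)
Lemma cc_block_graph : cc block_graph <= (n %/ k).+1 ^ 2.
Proof.
pose m := (n %/ k).+1.
pose f (p : 'I_m * 'I_m) := [set x : 'I_n | x %/ k == if x < n./2 then p.1 else p.2].
apply: leq_trans (_ : #|[set f p | p : 'I_m * 'I_m]| <= _); last first.
  by apply: leq_trans (leq_imset_card _ _) _; rewrite card_prod card_ord mulnn.
apply: (ccP _).2; apply/andP; split.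
  apply/forall_inP => _ /imsetP[p _ ->]; apply/forall_inP => x; rewrite inE => /eqP xp.
  apply/forall_inP => y; rewrite inE => /eqP yp; apply/implyP => xy.
  rewrite block_pair xy /= /block_rel xp yp; case: (x < _); case: (y < _) => //=; by rewrite eqxx.
apply/forall_inP => e eG; have [x [y [xy ee]]] := graph_pairP (sgraph_graph (G := block_graph)) eG.
have bm (z : 'I_n) : z %/ k < m by rewrite ltnS leq_div2r // ltnW.
move: eG; rewrite ee block_pair xy /= => rxy.
pose o z := Ordinal (bm z); apply/exists_inP.
exists (f (if x < n./2 then (o x, o y) else (o y, o x))); first exact: imset_f.
rewrite subUset !sub1set !inE; move: rxy; rewrite /block_rel.
by case: (x < _); case: (y < _) => /= rxy; rewrite ?(eqP rxy) !eqxx.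
Qed.

Lemma card_block (b : nat) : #|[set y : 'I_n | y %/ k == b]| <= k.
Proof.
pose f (y : 'I_n) := Ordinal (ltn_pmod y k0).
rewrite -[leqRHS]card_ord -(card_in_imset (f := f)) ?max_card //.
move=> y z; rewrite !inE => /eqP yb /eqP zb /(congr1 val) /= yz.
by apply: val_inj; rewrite /= (divn_eq y k) (divn_eq z k) yb zb yz.
Qed.

(** [cross_edges_le_cp] with the lower half as [A]: inner neighbours share a block, so there are at
    most [n * k] ordered inner pairs. *)
Lemma cp_block_graph : n ^ 2 %/ 4 <= cp block_graph + n * k.
Proof.
pose A := [set x : 'I_n | x < n./2].
have cA : #|A| = n./2.
  have hn : n./2 <= n by rewrite -divn2 leq_div.
  have inj : injective (widen_ord hn) by move=> x y /(congr1 val) /= /val_inj.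
  rewrite -[RHS]card_ord -(card_imset _ inj).
  apply: eq_card => x; rewrite inE; apply/idP/imsetP => [xh|[y _ ->]]; last exact: ltn_ord y.
  by exists (Ordinal xh) => //; apply: val_inj.
have cAC : #|~: A| = n - n./2 by rewrite cardsCs setCK card_ord cA.
have AG : {in A & ~: A, forall x y, [set x; y] \in edges block_graph}.
  move=> x y xA yA; have xh : x < n./2 by move: xA; rewrite inE.
  have yh : ~~ (y < n./2) by move: yA; rewrite !inE.
  rewrite block_pair /block_rel xh (negPf yh) /= andbT.
  by apply: contraNneq yh => <-.
have := cross_edges_le_cp AG; rewrite cA cAC => H.
have -> : n ^ 2 %/ 4 = n./2 * (n - n./2).
  rewrite -[n]odd_double_half; move: (n./2) (odd n) => m []; rewrite ?add0n ?add1n.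
    have -> : m.*2.+1 ^ 2 = (m * m + m) * 4 + 1 by lia.
    by rewrite divnMDl //= uphalf_double; lia.
  have -> : m.*2 ^ 2 = m * m * 4 by lia.
  by rewrite mulnK // doubleK; lia.
apply: leq_trans H _; rewrite leq_add2l.
apply: leq_trans (_ : \sum_(x : 'I_n) #|[set y : 'I_n | y %/ k == x %/ k]| <= _); last first.
  by rewrite -[X in X * k]card_ord -sum_nat_const; apply: leq_sum => x _; apply: card_block.
under eq_bigr do rewrite -sum1dep_card; rewrite pair_big_dep /= sum1dep_card.
apply: subset_leq_card; apply/subsetP => -[x y]; rewrite 2!inE /= in_set block_pair /block_rel !inE.
by move=> /andP[/andP[_ r] /eqP xy]; rewrite xy eqxx eq_sym in r.
Qed.

End BlockGraph.

Lemma sigma_lower n k : 0 < k -> n ^ 2 %/ 4 <= sigma n + n * k + (n %/ k).+1 ^ 2.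
Proof.
move=> k0; have := leq_bigmax (F := fun G : sgraph 'I_n => cp G - cc G) (block_graph n k).
rewrite -/(sigma n); have := cp_block_graph n k0; have := cc_block_graph n k.
clear; lia.
Qed.

(** * Elimination with small total gain *)

Section SmallGain.
Variables (T : finType) (x0 : T) (E0 : {set {set T}}) (k : nat).
Hypothesis gE0 : graph E0.
Hypothesis k_large : 56 <= k.
Hypothesis n_large : 1024 * k <= #|T|.
Hypothesis sparse : 7 * #|E0| < 3 * #|T| ^ 2.
Hypothesis gain_total : 1024 * \sum_(i < #|T|) gain x0 E0 i < #|T| * k.

Let n := #|T|.
(* During the first [t] steps the remaining graph is sparse enough for
   [gain_small]. *)
Let t := n %/ 128.
Let V := Vs x0 E0.
Let E := Es x0 E0.
Let v := vs x0 E0.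
Let N := Ns x0 E0.
Let M := Ms x0 E0.
Let I := Is x0 E0.
Let g := gain x0 E0.

(** Only losses through matchings; edges removed along with an endpoint are left out. *)
Definition deleted := \bigcup_(l < t) M l.

Fact window_le : 128 * t <= n. Proof. by rewrite mulnC leq_trunc_div. Qed.

Fact window_ge : n < 128 * t + 128. Proof. by rewrite /t; lia. Qed.

Fact window_lt i : i < t -> i < n.
Proof. by move: window_le; clear; lia. Qed.

Fact sum_gain_t : \sum_(i < t) g i <= \sum_(i < n) g i.
Proof.
have tn : t <= n by move: window_le; clear; lia.
by rewrite (big_ord_widen _ g tn) [leqRHS](bigID (fun i : 'I_n => i < t)) /= leq_addr.
Qed.

Fact card_deleted : 128 * #|deleted| <= n * k.
Proof.
have : #|deleted| <= \sum_(l < t) #|M l|.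
  rewrite /deleted; elim/big_ind2: _ => [|a A b B H1 H2|//]; first by rewrite cards0.
  by apply: leq_trans (leq_card_setU _ _).1 _; apply: leq_add.
have : \sum_(l < t) #|M l| <= \sum_(l < t) (7 * g l + 7).
  apply: leq_sum => l _; apply: gain_small => //; first by move: n_large k_large; clear; lia.
  by move: (ltn_ord l) window_le; clear; lia.
rewrite big_split /= -big_distrr /= sum_nat_const card_ord.
(* In [128 * #|deleted|] the gains account for less than [7/8 n k]; the additive 7 per step amounts
   to at most [7 n], which is within [n k / 8]. *)
have k1 : 56 * n <= n * k by rewrite mulnC leq_mul2l k_large orbT.
move: sum_gain_t gain_total window_le k1; rewrite -/g -/n.
move: (\sum_(i < t) g i) (\sum_(i < n) g i) (\sum_(l < t) _) #|deleted| (n * k) => a b c d e.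
clear; lia.
Qed.

Fact graph_deleted : graph deleted.
Proof.
apply: graphS gE0; apply/bigcupsP => l _; have [ME _ _] := and3P (Ms_matching x0 E0 l).
exact: subset_trans ME (Es_sub x0 E0 (leq0n l)).
Qed.

Fact mem_deleted j x y : j <= t -> [set x; y] \in E0 -> x \in V j -> y \in V j ->
  [set x; y] \notin E j -> [set x; y] \in deleted.
Proof.
move=> jt xyE xV yV nE; have xyV : [set x; y] \subset V j by rewrite subUset !sub1set xV.
have [l lj lM] := Es_deleted xyE xyV nE.
by apply/bigcupP; exists (Ordinal (leq_trans lj jt)).
Qed.

Fact Is_Ns i : I i \subset N i. Proof. exact: subsetDl. Qed.

Fact Ns_V i : N i \subset V i.
Proof. by apply: subset_trans (Ns_Vs x0 gE0 i) (subsetDl _ _). Qed.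

Fact Is_V i : I i \subset V i. Proof. exact: subset_trans (Is_Ns i) (Ns_V i). Qed.

(** [I i] is independent in [E i], so its edges in [E0] were all lost through matchings. *)
Fact edges_in_Is i (Y : {set T}) : i <= t -> Y \subset I i -> 128 * #|edges_in E0 Y| <= n * k.
Proof.
move=> it YI; apply: leq_trans card_deleted; rewrite leq_mul2l subset_leq_card //.
apply/subsetP => e; rewrite inE => /andP[eE eY].
have [x [y [_ ee]]] := graph_pairP gE0 eE.
move: eE eY; rewrite ee subUset !sub1set => eE /andP[xY yY].
have [xI yI] := (subsetP YI _ xY, subsetP YI _ yY).
by apply: (mem_deleted it eE); rewrite ?(subsetP (Is_V i)) //; apply: Is_indep xI yI.
Qed.

Definition poor i := (i < t) && (g i < k).

(** With gain at most [k - 1], [gain_small] gives [#|M i| <= 7 k]; the next two bounds unfold the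
    gain, [16 k] being [2 k + 14 k]. *)
Fact poor_bounds i : poor i ->
  [/\ #|M i| <= 7 * k, n <= 2 * #|N i| + i + 2 * k, n <= 2 * #|I i| + i + 16 * k,
      #|N i| <= n & 128 * i <= n].
Proof.
move=> /andP[it gk]; have iT := window_lt it.
have i128 : 128 * i <= n by move: it window_le; clear; lia.
have T0 : 0 < n by move: iT; clear; lia.
have := gain_small x0 gE0 T0 sparse i128.
have := gainE x0 gE0 iT; have := card_Is x0 gE0 i.
have := Ns_lt x0 gE0 iT.
rewrite -/n -/(M i) -/(N i) -/(I i) -/(g i).
move: gk i128; move: #|M i| #|N i| #|I i| (g i) n; clear => m d c a n.
move=> H1 H2 H3 H4 H5 H6; split; lia.
Qed.

Definition poors := [set i : 'I_t | g i < k].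

(** By Markov, fewer than [n / 1024] of the first [t] steps gain [k] or more, while [t] exceeds
    [n / 128 - 1]. *)
Fact card_poors : 3 * n <= 512 * #|poors|.
Proof.
have : #|~: poors| * k <= \sum_(i < t) g i.
  rewrite -sum_nat_const [leqRHS](bigID (mem (~: poors))) /=.
  apply: leq_trans (leq_addr _ _); apply: leq_sum => i.
  by rewrite !inE -leqNgt.
have := cardsC poors; rewrite card_ord.
move: sum_gain_t gain_total window_ge n_large k_large; rewrite -/g -/n.
move: (\sum_(i < t) g i) (\sum_(i < n) g i) #|poors| #|~: poors| => a b c d.
move: n t => m s.
clear => H1 H2 H3 H4 H5 H6 H7.
have : 1024 * d < m by nia.
lia.
Qed.

Lemma two_sparse_sides : exists X Y : {set T},
  [/\ #|edges_in E0 X| <= n * k, #|edges_in E0 Y| <= n * k &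
      n ^ 2 <= 1024 * (\sum_(x in X) #|nb E0 x :&: Y|)].
Proof.
have n0 : 0 < n by move: n_large k_large; rewrite -/n; clear; lia.
have [i1 i1P] : exists i1, i1 \in poors.
  by apply/set0Pn; rewrite -card_gt0; move: card_poors n0; clear; lia.
(* [i] is the first poor step. *)
case: (@arg_minnP _ i1 (mem poors) (fun i : 'I_t => i) i1P) => i iP imin.
have poorP (j : 'I_t) : j \in poors -> poor j by rewrite inE /poor ltn_ord.
pose X := I i; have [Mi Ni Ii Nin i128] := poor_bounds (poorP _ iP).
have EE j : i <= j -> E j \subset E i by apply: Es_sub.
have VV j : i <= j -> V j \subset V i by apply: Vs_sub.
have E0i j : E j \subset E0 by apply: (Es_sub x0 E0 (leq0n j)).
pose NB u := V i :\: X :\: nb (E i) u.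
(* [X] is independent in [E i], so all neighbours of [u], at least [#|N i|] in number, lie in
   [V i :\: X], a set larger than [N i] by at most [9 k]. *)
have cNB u : u \in X -> #|NB u| <= 10 * k.
  move=> uX; have uV := subsetP (Is_V i) _ uX.
  have du := vs_min (window_lt (ltn_ord i)) uV.
  have sub : nb (E i) u \subset V i :\: X.
    apply/subsetP => w uw; rewrite inE; apply/andP; split.
      by apply/negP => wX; have /negP[] := Is_indep gE0 uX wX; rewrite inE in uw.
    by move: uw; rewrite inE => /Es_Vs/subsetP; apply; apply: set22.
  have := cardsD (V i :\: X) (nb (E i) u); rewrite (setIidPr sub) -/(NB u).
  have := cardsD (V i) X; rewrite (setIidPr (Is_V i)).
  have := card_Vs x0 E0 (ltnW (window_lt (ltn_ord i))); rewrite -/V -/n.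
  move: du Ni Ii k_large; rewrite -/(N i) -/(E i) -/X.
  move: #|N i| #|nb _ _| #|V i| #|X| #|_ :\: _| #|NB u| => a b c d e f.
  clear; lia.
have edX : #|edges_in E0 X| <= n * k.
  have := edges_in_Is (ltnW (ltn_ord i)) (subxx X); clear; lia.
(* If a later [I j] is almost disjoint from [X = I i], these two sets are the
   sides. Otherwise [I j] contains a vertex [u] of [X] with few deleted edges;
   as [u] is adjacent to nearly everything outside [X], the set [N j] is nearly
   contained in [X], and the later poor vertices form the second side. *)
case: (boolP [exists j in poors, (i < j) && (8 * #|I j :&: X| <= n)]) => [/exists_inP|].
  move=> [j jP /andP[ij IjX]]; have [_ Nj Ij _ j128] := poor_bounds (poorP _ jP).
  pose Y := I j :\: X; exists X, Y; split=> //.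
    have := edges_in_Is (ltnW (ltn_ord j)) (subsetDl (I j) X); rewrite -/Y; clear; lia.
  (* [Y] has more than [n / 3] vertices, of which [u] misses at most [10 k]. *)
  have cross u : u \in X -> n <= 8 * #|nb E0 u :&: Y|.
    move=> uX; have sub : Y :\: NB u \subset nb E0 u :&: Y.
      apply/subsetP => w /setDP[wY wNB]; apply/setIP; split=> //.
      case/setDP: (wY) => wI wX; apply: contraR wNB => nuw.
      rewrite in_setD in_setD wX (subsetP (VV _ (ltnW ij))) ?(subsetP (Is_V j)) // andbT.
      rewrite andbT; apply: contra nuw; apply: (subsetP (nbS u (E0i i))).
    have := subset_leq_card sub; have := cNB _ uX; have := cardsD Y (NB u).
    have := subset_leq_card (subsetIr Y (NB u)).
    have := cardsD (I j) X; rewrite -/Y.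
    move: Ij IjX j128 n_large k_large; rewrite -/n; move: n => m.
    move: #|I j| #|_ :&: X| #|Y| #|NB u| #|_ :&: NB u| #|_ :\: NB u| #|_ :&: Y| => a b c d e f h.
    clear; lia.
  have : #|X| * n <= 8 * \sum_(x in X) #|nb E0 x :&: Y|.
    by rewrite big_distrr -sum_nat_const /=; apply: leq_sum => u /cross.
  (* The factor [1024] arises as [128 * 8] here and as [256 * 4] in the other case. *)
  have : n <= 128 * #|X|.
    move: Ii i128 n_large; rewrite -/n -/X; move: n #|X| => m x; clear; lia.
  move: n #|X| (\sum_(x in X) _) => m x s; clear; rewrite !expnS expn0; nia.
rewrite negb_exists_in => /forall_inP caseb.
(* [25 k] collects [10 k] non-neighbours of a suitable [u], [k] deleted edges at [u] and [14 k]
   matched vertices. *)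
have nbj (j : 'I_t) : j \in poors -> i < j -> #|N j :\: X| <= 25 * k.
  move=> jP ij; have [Mj Nj Ij _ j128] := poor_bounds (poorP _ jP).
  have IX : n < 8 * #|I j :&: X| by have := caseb _ jP; rewrite ij /= -ltnNge.
  (* By [card_high], fewer than [n / 8] vertices have more than [k] deleted edges. *)
  have [u uIX du] : exists2 u, u \in I j :&: X & #|nb deleted u| <= k.
    have hi := card_high k graph_deleted.
    have : ~~ (I j :&: X \subset [set x | k < #|nb deleted x|]).
      apply/negP => /subset_leq_card; move: IX hi card_deleted.
      move: #|_ :&: _| #|[set _ | _]| #|deleted| => a b c; clear => H1 H2 H3 H4.
      have : b * k.+1 * 64 <= n * k by lia.
      have : n * k.+1 < 8 * b * k.+1 by rewrite ltn_pmul2r //; lia.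
      by rewrite mulnS; lia.
    by case/subsetPn => u uI; rewrite inE -leqNgt => du; exists u.
  have [uI uX] := setIP uIX.
  (* A neighbour [w] of [u] in [E i] is no longer adjacent to [u] in [E j], since [I j] is
     independent; the edge was thus deleted. *)
  have sub : I j :\: X \subset NB u :|: nb deleted u.
    apply/subsetP => w /setDP[wI wX].
    have wVj := subsetP (Is_V j) _ wI; have uVj := subsetP (Is_V j) _ uI.
    rewrite inE; case: (boolP (w \in nb (E i) u)) => [uw|nuw]; last first.
      by apply/orP; left; rewrite inE nuw inE wX (subsetP (VV _ (ltnW ij))).
    apply/orP; right; rewrite inE in uw; rewrite inE.
    apply: (mem_deleted (ltnW (ltn_ord j)) _ uVj wVj).
      exact: subsetP (E0i i) _ uw.
    exact: Is_indep uI wI.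
  have sub2 : N j :\: X \subset (I j :\: X) :|: cover (M j).
    apply/subsetP => w /setDP[wN wX]; rewrite inE [_ \in _ :\: _]inE wX inE wN /=.
    by rewrite andbT orNb.
  have := subset_leq_card sub; have := (leq_card_setU (NB u) (nb deleted u)).1.
  have := subset_leq_card sub2; have := (leq_card_setU (I j :\: X) (cover (M j))).1.
  have := card_cover_Ms x0 gE0 j; have := cNB _ uX; rewrite -/(M j).
  move: Mj du; move: #|cover _| #|M j| #|nb _ _| #|NB u| #|_ :|: _| #|_ :|: _| #|_ :\: _| #|_ :\: _|.
  clear; lia.
have crossj (j : 'I_t) : j \in poors -> i < j -> n <= 4 * #|N j :&: X|.
  move=> jP ij; have [Mj Nj Ij _ j128] := poor_bounds (poorP _ jP).
  have := cardsID X (N j); have := nbj _ jP ij; move: Nj j128 n_large; rewrite -/n.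
  move: n #|N j| #|_ :&: _| #|_ :\: _| => m a b c; clear; lia.
pose J := [set j in poors | (i < j)].
(* No poor step precedes [i], so [J] loses only [i] itself. *)
have JE : J = poors :\ i.
  apply/setP => j; rewrite !inE; case: (ltngtP j i) => [ji|ij|/val_inj ->]; rewrite ?eqxx ?ltnn ?andbF //.
    have /negbTE -> : ~~ (g j < k); last by rewrite andbF.
    by apply/negP => gj; have := imin j; rewrite /= inE gj leqNgt ji => /(_ erefl).
  suff -> : j != i by rewrite andbT.
  by apply: contraTneq ij => ->; rewrite ltnn.
pose vJ (j : 'I_t) := v j; pose Y := [set vJ j | j in J].
have vinj : injective vJ.
  move=> j l; apply: contra_eq; case: (ltngtP j l) => [jl|lj|/val_inj -> /eqP//] _.
    exact: (vs_neq x0 E0 jl (window_lt (ltn_ord l))).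
  by rewrite eq_sym; apply: (vs_neq x0 E0 lj (window_lt (ltn_ord j))).
have cY : #|Y| = #|J| by rewrite card_imset.
have JP j : j \in J -> j \in poors /\ i < j by rewrite inE => /andP.
have cJ : n <= 256 * #|J|.
  have := cardsD1 i poors; rewrite (iP : i \in poors) -JE; have := card_poors; move: n_large k_large.
  rewrite -/n; move: n #|J| #|poors| => m a b; clear; lia.
(* A vertex [v j] in the independent set [X] would have no neighbours in [X], against [crossj]. *)
have YX y : y \in Y -> y \notin X.
  case/imsetP => j /JP[jP ij] ->; apply/negP => vX.
  have : 0 < #|N j :&: X| by move: (crossj _ jP ij) n0; clear; lia.
  rewrite card_gt0 => /set0Pn[w /setIP[wN wX]]; rewrite inE in wN.
  by have /negP[] := Is_indep gE0 vX wX; apply: subsetP (EE _ (ltnW ij)) _ wN.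
exists Y, X; split=> //; last first.
  have : #|J| * n <= 4 * \sum_(y in Y) #|nb E0 y :&: X|.
    rewrite -cY big_distrr -sum_nat_const /=; apply: leq_sum => y /imsetP[j /JP[jP ij] ->].
    apply: leq_trans (crossj _ jP ij) _; rewrite leq_mul2l /=.
    by apply: subset_leq_card; apply: setSI; apply: nbS.
  move: cJ; move: n #|J| (\sum_(x in Y) _) => m x s; clear; rewrite !expnS expn0; nia.
(* An edge inside [Y] that is not in [deleted] still exists when its earlier endpoint [v a] is
   removed, so it joins [v a] to one of the at most [25 k] vertices of [N a :\: X]. *)
have cov : #|edges_in E0 Y :\: deleted| <= #|J| * (25 * k).
  apply: (@card_le_cover _ _ _ _ (fun j : 'I_t => [set [set v j; w] | w in N j :\: X])).
    move=> e /setDP[]; rewrite inE => /andP[eE eY] ed.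
    have [x [y [xy ee]]] := graph_pairP gE0 eE.
    move: (eY); rewrite ee subUset !sub1set => /andP[/imsetP[j jJ xj] /imsetP[l lJ yl]].
    have key (a b : 'I_t) : a \in J -> b \in J -> a < b -> [set v a; v b] \in E0 ->
        [set v a; v b] \notin deleted -> [set v a; v b] \in [set [set v a; w] | w in N a :\: X].
      move=> aJ bJ ab abE; apply: contraR => H.
      apply: (mem_deleted (ltnW (ltn_ord a)) abE).
      - exact: vs_Vs (window_lt (ltn_ord a)).
      - exact: subsetP (Vs_sub x0 E0 (ltnW ab)) _ (vs_Vs x0 E0 (window_lt (ltn_ord b))).
      apply: contra H => abEa; apply: imset_f; rewrite inE YX ?inE //; exact: (imset_f vJ).
    have [jl|lj|jl] := ltngtP j l.
    - have ev : e = [set v j; v l] by rewrite ee xj yl.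
      by exists j => //; rewrite -ee ev; apply: key; rewrite -?ev.
    - have ev : e = [set v l; v j] by rewrite ee xj yl setUC.
      by exists l => //; rewrite -ee ev; apply: key; rewrite -?ev.
    - by move: xy; rewrite xj yl (val_inj jl) eqxx.
  move=> j /JP[jP ij]; apply: leq_trans (subset_leq_card (subsetIr _ _)) _.
  exact: leq_trans (leq_imset_card _ _) (nbj _ jP ij).
have cJt : #|J| <= t by apply: leq_trans (max_card _) _; rewrite card_ord.
have := cardsID deleted (edges_in E0 Y).
have := subset_leq_card (subsetIr (edges_in E0 Y) deleted).
have : 128 * (#|J| * (25 * k)) <= 25 * (n * k).
  by move: window_le cJt; move: #|J| => a; move: n t => m s; clear; nia.
move: cov card_deleted; move: (#|J| * _) (n * k) #|_ :\: _| #|_ :&: _| #|edges_in _ _| #|deleted|.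
clear; lia.
Qed.

End SmallGain.

Lemma small_gain_cc (T : finType) (x0 : T) (G : sgraph T) k :
  56 <= k -> k ^ 3 <= #|T| -> 7 * #|edges G| < 3 * #|T| ^ 2 ->
  1024 * \sum_(i < #|T|) gain x0 (edges G) i < #|T| * k ->
  #|T| * k <= (8 * 1024) ^ 3 * cc G.
Proof.
move=> k56 kn sparse small.
have nk : 1024 * k <= #|T| by apply: leq_trans kn; rewrite !expnS expn0; nia.
have [X [Y [XB YB]]] := two_sparse_sides (sgraph_graph (G := G)) k56 nk sparse small.
(* This choice makes the left side of [cross_edges_le_cc] at least [8 k n^2] with [n = #|T|], twice
   the error term [4 B n] for [B = n k]. The other half must come from [cc G]. *)
have [K KE] : exists K, K.+1 = 8 * 1024 * k by exists (8 * 1024 * k).-1; lia.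
have := cross_edges_le_cc K XB YB; rewrite KE expnMn.
have k0 : 0 < k ^ 3 by rewrite expn_gt0; move: k56; clear; lia.
move: kn k0.
move: ((8 * 1024) ^ 3) (k ^ 3) (\sum_(x in X) _) => q3 k3 C kn k0 H YC.
have H1 : 8 * (k * #|T| ^ 2) <= 8 * (k * (1024 * C)) by rewrite !leq_mul2l YC !orbT.
have H2 : k * #|T| * k3 <= k * #|T| ^ 2 by rewrite expnS expn1 mulnA leq_mul2l kn orbT.
rewrite -(leq_pmul2r k0); move: H H1 H2; rewrite expnS expn1.
clear; lia.
Qed.

(** * The two bounds *)

(** In dense graphs [dense_packing], and for large total gain [cp_gain], pushes [cp G] itself below
    the quadratic term. Otherwise [small_gain_cc] makes [cc G] large enough. *)
Lemma cp_cc_upper (n k : nat) (G : sgraph 'I_n.+1) : 56 <= k -> k ^ 3 <= n.+1 ->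
  (8 * 1024) ^ 3 * (cp G - cc G) + n.+1 * k <= (8 * 1024) ^ 3 * (n.+1 ^ 2 %/ 4).
Proof.
move=> k56 kn; have gG := sgraph_graph (G := G); have := cp_gain ord0 G.
have [q q1024 qE] : exists2 q, 1024 <= q & q = (8 * 1024) ^ 3.
  by exists ((8 * 1024) ^ 3).
rewrite -qE card_ord; set S := (\sum_(i < _) _) => cpS.
have cpf : cp G <= n.+1 ^ 2 %/ 4 by apply: leq_trans cpS; rewrite leq_addr.
have qcp : q * cp G <= q * (n.+1 ^ 2 %/ 4) by rewrite leq_mul2l cpf orbT.
have large_gap : n.+1 * k <= 1024 * (n.+1 ^ 2 %/ 4 - cp G) ->
    q * (cp G - cc G) + n.+1 * k <= q * (n.+1 ^ 2 %/ 4).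
  move=> /leq_trans/(_ (leq_mul q1024 (leqnn _))); rewrite mulnBr => gap.
  have : q * (cp G - cc G) <= q * cp G by rewrite leq_mul2l leq_subr orbT.
  move: gap qcp; clear; lia.
case: (ltnP (7 * #|edges G|) (3 * n.+1 ^ 2)) => [sparse|dense]; last first.
  (* With [m = n.+1], [cp G <= 2/3 m^2 - #|edges G| <= 5/21 m^2], which is [m^2 / 84] below
     [m^2 / 4]; the factor [168 = 2 * 84] leaves room for rounding. *)
  apply: large_gap; have [P /cp_packing cpP EP] := dense_packing gG.
  have kn2 : 168 * k <= n.+1 by apply: leq_trans kn; rewrite !expnS expn0; nia.
  have : n.+1 * (168 * k) <= n.+1 ^ 2 by rewrite -mulnn leq_mul2l kn2 orbT.
  have : 56 * n.+1 <= n.+1 * k by rewrite mulnC leq_mul2l k56 orbT.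
  have : n.+1 ^ 2 <= 4 * (n.+1 ^ 2 %/ 4) + 3 by lia.
  move: dense cpP EP kn2 k56.
  move: (cp G) #|edges G| #|P| (n.+1 ^ 2 %/ 4) => c e p f.
  rewrite mulnCA; move: (n.+1 ^ 2) (n.+1 * k) => n2 nk; clear; lia.
case: (ltnP (1024 * S) (n.+1 * k)) => [small|large]; last first.
  by apply: large_gap; apply: leq_trans large _; rewrite leq_mul2l leq_subRL ?cpS ?orbT.
have := @small_gain_cc _ ord0 G k k56; rewrite card_ord -qE => /(_ kn sparse small) nk.
have qcc : q * cc G <= q * cp G by rewrite leq_mul2l cc_le_cp orbT.
by rewrite mulnBr; apply: leq_trans qcp; rewrite -[leqRHS](subnK qcc) leq_add2l.
Qed.

Lemma sigma_upper (n k : nat) : 56 <= k -> k ^ 3 <= n ->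
  (8 * 1024) ^ 3 * sigma n + n * k <= (8 * 1024) ^ 3 * (n ^ 2 %/ 4).
Proof.
case: n => [|n] k56 kn; first by move: k56 kn; rewrite !expnS expn0; nia.
rewrite /sigma; have [|G ->] := @eq_bigmax (sgraph 'I_n.+1) (fun G => cp G - cc G).
  (* Any graph would do: the maximum must range over a nonempty type. *)
  by apply/card_gt0P; exists (block_graph n.+1 1).
exact: cp_cc_upper.
Qed.

Lemma cube_root (n : nat) : exists k, k ^ 3 <= n < k.+1 ^ 3.
Proof.
elim: n => [|n [k /andP[kn nk]]]; first by exists 0.
case: (leqP (k.+1 ^ 3) n.+1) => H; last by exists k; rewrite H (leq_trans kn).
by exists k.+1; rewrite H (leq_ltn_trans nk) // ltn_exp2r.
Qed.

(** * Real powers and the final constants *)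

Import Order.TTheory GRing.Theory Num.Theory.
Local Open Scope ring_scope.

(** [k] is the integer part of the cube root [r] of [n], so [k <= r <= k + 1 <= 2 k]. *)
Lemma powR43_bounds (R : realType) (n k : nat) : (0 < k)%N -> (k ^ 3 <= n < k.+1 ^ 3)%N ->
  (n * k)%:R <= n%:R `^ (4%:R / 3%:R) :> R /\ n%:R `^ (4%:R / 3%:R) <= 2 * (n * k)%:R :> R.
Proof.
move=> k0 /andP[kn nk]; have n0 : (0 < n)%N by apply: leq_trans kn; rewrite expn_gt0 k0.
set r : R := n%:R `^ 3%:R^-1.
have r0 : 0 <= r by apply: powR_ge0.
have r3 : r ^+ 3 = n%:R.
  by rewrite -powR_mulrn // -powRrM mulVf ?powRr1 // pnatr_eq0.
have -> : n%:R `^ (4%:R / 3%:R) = n%:R * r.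
  have -> : 4%:R / 3%:R = 1 + 3%:R^-1 :> R by field.
  by rewrite powRD ?powRr1 // pnatr_eq0 -lt0n n0 implybT.
have kr : k%:R <= r by rewrite -(@ler_pXn2r _ 3) ?nnegrE // r3 -natrX ler_nat.
have rk : r <= k.+1%:R by rewrite -(@ler_pXn2r _ 3) ?nnegrE // r3 -natrX ler_nat ltnW.
rewrite natrM mulrCA !ler_pM2l ?ltr0n //; split=> //.
by apply: le_trans rk _; rewrite -natrM ler_nat; lia.
Qed.

Theorem theorem1p2 (R : realType) :
  exists C1 C2 : R, [/\ 0 < C1, 0 < C2 &
    exists N : nat, forall n : nat, (N <= n)%N ->
      (n ^ 2 %/ 4)%N%:R - C1 * (n%:R `^ (4%:R / 3%:R)) <= (sigma n)%:R
      /\ (sigma n)%:R <= (n ^ 2 %/ 4)%N%:R - C2 * (n%:R `^ (4%:R / 3%:R))].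
Proof.
(* [A] hides the large numeral from the arithmetic that follows. *)
have [A A0 HA] : exists2 A : nat, (0 < A)%N & forall n k : nat, (56 <= k)%N -> (k ^ 3 <= n)%N ->
    (A * sigma n + n * k <= A * (n ^ 2 %/ 4))%N.
  by exists ((8 * 1024) ^ 3)%N; [rewrite expn_gt0|apply: sigma_upper].
have A0' : 0 < A%:R :> R by rewrite ltr0n.
(* [82 = 1 + 81] adds the two error terms of [sigma_lower]; the factor 2 is that of
   [powR43_bounds]. *)
exists 82, (2 * A%:R)^-1; split; [by []|by rewrite invr_gt0 mulr_gt0|].
exists (56 ^ 3)%N => n Nn; have [k /andP[kn nk]] := cube_root n.
have k56 : (56 <= k)%N.
  by rewrite leqNgt; apply/negP => k56; have := leq_ltn_trans Nn nk; rewrite ltn_exp2r // ltnNge k56.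
have k0 : (0 < k)%N by apply: leq_trans k56.
have [lo hi] := @powR43_bounds R n k k0 (introT andP (conj kn nk)).
split.
  have : (n ^ 2 %/ 4 <= sigma n + 82 * (n * k))%N.
    apply: leq_trans (sigma_lower n k0) _.
    (* Because [n < (k + 1)^3 <= 8 k^3]. *)
    have H : ((n %/ k).+1 <= 9 * k ^ 2)%N.
      have : (n %/ k <= 8 * k ^ 2)%N.
        rewrite -ltnS ltn_divLR //; apply: leq_trans nk _.
        move: k0; rewrite !expnS expn0; nia.
      by move: k0; rewrite !expnS expn0; nia.
    have : ((n %/ k).+1 ^ 2 <= 81 * (n * k))%N.
      apply: leq_trans (_ : (9 * k ^ 2) ^ 2 <= _)%N; first by rewrite leq_exp2r.
      apply: leq_trans (_ : 81 * (k ^ 3 * k) <= _)%N; last by rewrite leq_mul2l leq_mul2r kn orbT.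
      by rewrite !expnS expn0; lia.
    lia.
  by rewrite -(ler_nat R) natrD natrM; lra.
have := HA n k k56 kn; rewrite -(ler_nat R) natrD !natrM => H.
rewrite lerBrDr -(ler_pM2l A0') mulrDr; apply: le_trans H; rewrite lerD2l.
rewrite mulrA invfM mulrCA mulfV ?gt_eqF // mulr1.
move: hi; rewrite natrM; lra.
Qed.
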